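(* Let $n\geq 1$, let $\mathcal{C}$ be a collection of intervals on $\{1,\dots,n\}$ and let $\Gamma=\Gamma(\mathcal{C})$ be the associated (finite) interval graph. Let $$\mathcal{P}(\mathcal{C})=\langle x_1,\dots,x_n,a_I,b_I,c_I\ (I\in\mathcal{C})\mid x_I=a_I,\ a_I=b_I,\ b_I=c_I,\ c_I=a_I\ (I\in\mathcal{C})\rangle,$$ where $x_I=x_{i_1}\cdots x_{i_r}$ for $I=(i_1,\dots,i_r)$. Then the diagram group $D(\mathcal{P}(\mathcal{C}),x_1\cdots x_n)$ is isomorphic to the right-angled Artin group $A(\overline{\Gamma})$.
   Context: Intervals on $\{1,\dots,n\}$ are non-empty sets of consecutive integers, listed in increasing order $I=(i_1,\dots,i_r)$. $\Gamma(\mathcal{C})$ is the graph whose vertices are the elements of $\mathcal{C}$ and whose edges link two (distinct) intersecting intervals. The complement $\overline{\Gamma}$ has the same vertices, and two distinct vertices are linked in $\overline{\Gamma}$ iff they are not linked in $\Gamma$ (i.e. the intervals are disjoint). For a simplicial graph $\Lambda$, $A(\Lambda)=\langle v\in V(\Lambda)\mid [u,v]=1,\ (u,v)\in E(\Lambda)\rangle$. A semigroup presentation $\mathcal{P}=\langle\Sigma\mid\mathcal{R}\rangle$ consists of an alphabet $\Sigma$ and a set $\mathcal{R}$ of relations $u=v$ with $u,v\in\Sigma^+$, where $\Sigma^+$ is the free semigroup of non-empty words and $\Sigma^*=\Sigma^+\cup\{1\}$ also contains the empty word. The Squier complex $S(\mathcal{P})$ is the cube complex whose vertices are the words over $\Sigma$;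 whose oriented edges are $(a,u\to v,b)$ with $a,b\in\Sigma^*$ and $u=v$ or $v=u$ in $\mathcal{R}$, going from $aub$ to $avb$ (and $(a,v\to u,b)$ is the same edge with opposite orientation); and whose $n$-cubes are similarly $(a_1,u_1\to v_1,\dots,a_n,u_n\to v_n,a_{n+1})$, spanned by the vertices $a_1w_1\cdots a_nw_na_{n+1}$ with $w_i\in\{u_i,v_i\}$. For $w\in\Sigma^+$, $S(\mathcal{P},w)$ is the connected component containing $w$, and the diagram group $D(\mathcal{P},w)$ is $\pi_1(S(\mathcal{P},w),w)$. *)

(* Defs.v *)
From HB Require Import structures.
From mathcomp Require Import all_boot.
From mathcomp Require Import generic_quotient boolp.
From Stdlib Require Import Relation_Operators.

Set Implicit Arguments.
Unset Strict Implicit.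
Unset Printing Implicit Defensive.

Local Open Scope quotient_scope.

(* The group of classes of a monoid under the equivalence relation generated by
   gdstep. It serves both for groups given by generators and relators and for
   edge-loop groups; in the latter case gdstep is not generated, as a monoid
   congruence, by pairs of loops, hence the explicit gdstepl and gdstepr. *)
Record groupData := GroupData {
  gdsort :> choiceType;
  gdmul : gdsort -> gdsort -> gdsort;
  gdone : gdsort;
  gdinv : gdsort -> gdsort;
  gdstep : gdsort -> gdsort -> Prop;
  gdmulA : associative gdmul;
  gdmul1 : left_id gdone gdmul;
  gdmulr1 : right_id gdone gdmul;
  gdstepl : forall z x y, gdstep x y -> gdstep (gdmul z x) (gdmul z y);
  gdstepr : forall z x y, gdstep x y -> gdstep (gdmul x z) (gdmul y z);
  gdmulV : forall x,
    clos_refl_sym_trans gdsort gdstep (gdmul x (gdinv x)) gdone;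
  gdmulVl : forall x,
    clos_refl_sym_trans gdsort gdstep (gdmul (gdinv x) x) gdone
}.

Section QuotientGroup.
Variable G : groupData.
Local Notation crst := (clos_refl_sym_trans (gdsort G) (@gdstep G)).

Definition gdeq : rel G := fun x y => `[< crst x y >].

Lemma gdeq_refl : reflexive gdeq.
Proof. by move=> x; apply/asboolP; apply: rst_refl. Qed.

Lemma gdeq_sym : symmetric gdeq.
Proof. by move=> x y; apply/asboolP/asboolP; exact: rst_sym. Qed.

Lemma gdeq_trans : transitive gdeq.
Proof.
move=> y x z /asboolP xy /asboolP yz; apply/asboolP.
exact: rst_trans xy yz.
Qed.

Canonical gdequiv := EquivRel gdeq gdeq_refl gdeq_sym gdeq_trans.

Definition quotGroup := {eq_quot gdequiv}.

HB.instance Definition _ := Choice.on quotGroup.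
HB.instance Definition _ := Quotient.on quotGroup.

Lemma crst_mul x x' y y' :
  crst x x' -> crst y y' -> crst (gdmul x y) (gdmul x' y').
Proof.
move=> xx' yy'; apply: (@rst_trans _ _ _ (gdmul x' y)).
  elim: xx' => [a b ab|a|a b _ ab|a b c _ ab _ bc].
  - by apply: rst_step; apply: gdstepr.
  - exact: rst_refl.
  - exact: rst_sym.
  - exact: rst_trans ab bc.
elim: yy' => [a b ab|a|a b _ ab|a b c _ ab _ bc].
- by apply: rst_step; apply: gdstepl.
- exact: rst_refl.
- exact: rst_sym.
- exact: rst_trans ab bc.
Qed.

Lemma crst_inv x y : crst x y -> crst (gdinv x) (gdinv y).
Proof.
move=> xy.
have h1 : crst (gdinv x) (gdmul (gdinv x) (gdmul y (gdinv y))).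
  rewrite -[X in crst X](gdmulr1 (gdinv x)).
  apply: crst_mul; first exact: rst_refl.
  by apply: rst_sym; apply: gdmulV.
apply: rst_trans h1 _; rewrite gdmulA.
rewrite -[X in crst _ X](gdmul1 (gdinv y)).
apply: crst_mul; last exact: rst_refl.
apply: (@rst_trans _ _ _ (gdmul (gdinv x) x)); last exact: gdmulVl.
by apply: crst_mul; [exact: rst_refl | exact: rst_sym].
Qed.

Lemma quot_eqP x y : reflect (crst x y) (\pi_quotGroup x == \pi_quotGroup y).
Proof. by apply: (iffP idP); rewrite piE => /asboolP. Qed.

Lemma repr_crst x : crst (repr (\pi_quotGroup x)) x.
Proof. by apply/quot_eqP; rewrite reprK. Qed.

Definition quot_one : quotGroup := \pi_quotGroup (gdone G).
Definition quot_inv (x : quotGroup) : quotGroup := \pi_quotGroup (gdinv (repr x)).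
Definition quot_mul (x y : quotGroup) : quotGroup :=
  \pi_quotGroup (gdmul (repr x) (repr y)).

Lemma quot_mulE x y :
  quot_mul (\pi_quotGroup x) (\pi_quotGroup y) = \pi_quotGroup (gdmul x y).
Proof. by apply/eqP/quot_eqP; apply: crst_mul; apply: repr_crst. Qed.

Lemma quot_invE x :
  quot_inv (\pi_quotGroup x) = \pi_quotGroup (gdinv x).
Proof. by apply/eqP/quot_eqP; apply: crst_inv; apply: repr_crst. Qed.

Lemma quot_mulA : associative quot_mul.
Proof.
move=> x y z.
elim/quotW: x => x; elim/quotW: y => y; elim/quotW: z => z.
by rewrite (quot_mulE y z) (quot_mulE x y) (quot_mulE x) (quot_mulE _ z) gdmulA.
Qed.

Lemma quot_mul1 : left_id quot_one quot_mul.
Proof. by move=> x; elim/quotW: x => x; rewrite /quot_one quot_mulE gdmul1. Qed.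

Lemma quot_mulr1 : right_id quot_one quot_mul.
Proof. by move=> x; elim/quotW: x => x; rewrite /quot_one quot_mulE gdmulr1. Qed.

Lemma quot_mulV : left_inverse quot_one quot_inv quot_mul.
Proof.
move=> x; elim/quotW: x => x; rewrite quot_invE quot_mulE; apply/eqP/quot_eqP.
exact: gdmulVl.
Qed.

Lemma quot_mulrV : right_inverse quot_one quot_inv quot_mul.
Proof.
move=> x; elim/quotW: x => x; rewrite quot_invE quot_mulE; apply/eqP/quot_eqP.
exact: gdmulV.
Qed.

HB.instance Definition _ :=
  isGroup.Build quotGroup quot_mulA quot_mul1 quot_mulr1 quot_mulV quot_mulrV.

End QuotientGroup.

Definition isomorphic_groups (G H : groupType) : Prop :=
  exists f : {multiplicative G -> H}, bijective f.

Section PresentedGroup.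
Variable S : choiceType.

(* The letter (s, true) stands for s and (s, false) for its inverse. *)
Definition gword := seq (S * bool).

Variable relator : gword -> Prop.

Inductive gword_step : gword -> gword -> Prop :=
| GwordCancel (p q : gword) (s : S) (b : bool) :
    gword_step (p ++ q) (p ++ [:: (s, b); (s, ~~ b)] ++ q)
| GwordRelator (p q r : gword) :
    relator r -> gword_step (p ++ q) (p ++ r ++ q).

Definition gword_inv (w : gword) : gword := rev [seq (x.1, ~~ x.2) | x <- w].

Lemma gword_stepl z x y : gword_step x y -> gword_step (z ++ x) (z ++ y).
Proof.
by case=> [p q s b|p q r rr]; rewrite !(catA z); [left | right].
Qed.

Lemma gword_stepr z x y : gword_step x y -> gword_step (x ++ z) (y ++ z).
Proof.
by case=> [p q s b|p q r rr]; rewrite -!catA; [left | right].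
Qed.

Lemma gword_mulV x :
  clos_refl_sym_trans gword gword_step (x ++ gword_inv x) [::].
Proof.
elim/last_ind: x => [|x [s b] ih] /=; first exact: rst_refl.
apply: rst_trans ih; apply: rst_sym; apply: rst_step.
rewrite /gword_inv map_rcons rev_rcons -cats1 -catA /=.
exact: (GwordCancel x _ s b).
Qed.

Lemma gword_invK : involutive gword_inv.
Proof.
move=> x; rewrite /gword_inv map_rev revK -map_comp -[RHS]map_id.
by apply: eq_map => -[s b] /=; rewrite negbK.
Qed.

Lemma gword_mulVl x :
  clos_refl_sym_trans gword gword_step (gword_inv x ++ x) [::].
Proof. by rewrite -{2}[x]gword_invK; apply: gword_mulV. Qed.

Definition presented_groupData : groupData :=
  @GroupData gword cat [::] gword_inv gword_step (@catA _) (@cat0s _) (@cats0 _)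
    gword_stepl gword_stepr gword_mulV gword_mulVl.

Definition presented_group : groupType := quotGroup presented_groupData.

End PresentedGroup.

Record sgraph := SGraph {
  svertex :> finType;
  sedge : rel svertex;
  sedge_sym : symmetric sedge;
  sedge_irr : irreflexive sedge
}.

Section Complement.
Variable L : sgraph.

Definition compl_edge : rel L := fun u v => (u != v) && ~~ sedge u v.

Lemma compl_edge_sym : symmetric compl_edge.
Proof. by move=> u v; rewrite /compl_edge eq_sym sedge_sym. Qed.

Lemma compl_edge_irr : irreflexive compl_edge.
Proof. by move=> u; rewrite /compl_edge eqxx. Qed.

Definition compl_graph : sgraph := SGraph compl_edge_sym compl_edge_irr.

End Complement.

Inductive raag_relator (L : sgraph) : gword L -> Prop :=
| RaagCommutator (u v : L) : sedge u v ->
    raag_relator [:: (u, true); (v, true); (u, false); (v, false)].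

Definition raag (L : sgraph) : groupType := presented_group (@raag_relator L).

(* [cube n] is the type of oriented n-cubes: n-cubes together with a direction
   along each of their n axes. [face i e c] is the face of c where the i-th
   coordinate is 0 (e = false) or 1 (e = true), and [flip i c] is the cube c
   with the direction of the i-th axis reversed. *)
Record cubeComplex := CubeComplex {
  cube : nat -> choiceType;
  face : forall n, 'I_n.+1 -> bool -> cube n.+1 -> cube n;
  flip : forall n, 'I_n -> cube n -> cube n;
  face_face : forall n (i j : 'I_n.+1) (d e : bool) (c : cube n.+2), i <= j ->
    face i d (face (lift ord0 j) e c) =
    face j e (face (widen_ord (leqnSn n.+1) i) d c);
  face_flip : forall n (i : 'I_n.+1) (e : bool) (c : cube n.+1),
    face i e (flip i c) = face i (~~ e) c;
  face_flip_lift : forall n (i : 'I_n.+1) (j : 'I_n) (e : bool) (c : cube n.+1),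
    face i e (flip (lift i j) c) = flip j (face i e c);
  flipK : forall n (i : 'I_n) (c : cube n), flip i (flip i c) = c;
  flipC : forall n (i j : 'I_n) (c : cube n),
    flip i (flip j c) = flip j (flip i c)
}.

Section FundamentalGroup.
Variable K : cubeComplex.

Definition vertex := cube K 0.
Definition edge := cube K 1.
Definition square := cube K 2.

Definition src (e : edge) : vertex := face ord0 false e.
Definition tgt (e : edge) : vertex := face ord0 true e.
Definition einv (e : edge) : edge := flip ord0 e.

Fixpoint edge_path (x : vertex) (p : seq edge) (y : vertex) : bool :=
  if p is e :: p' then (src e == x) && edge_path (tgt e) p' y else x == y.

Lemma edge_path_cat x p q z : edge_path x (p ++ q) z ->
  exists2 y, edge_path x p y & edge_path y q z.
Proof.
elim: p x => [|e p ih] x /=; first by move=> h; exists x.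
by case/andP=> ex /ih[y py qy]; exists y; rewrite // ex py.
Qed.

Lemma cat_edge_path x y z p q :
  edge_path x p y -> edge_path y q z -> edge_path x (p ++ q) z.
Proof.
elim: p x => [|e p ih] x /= => [/eqP->//|/andP[-> /ih h] /h ->//].
Qed.

Definition rev_path (p : seq edge) : seq edge := rev (map einv p).

Lemma src_einv e : src (einv e) = tgt e.
Proof. exact: face_flip. Qed.

Lemma tgt_einv e : tgt (einv e) = src e.
Proof. exact: face_flip. Qed.

Lemma einvK : involutive einv.
Proof. exact: flipK. Qed.

Lemma rev_pathK : involutive rev_path.
Proof.
move=> p; rewrite /rev_path map_rev revK -map_comp -[RHS]map_id.
by apply: eq_map => e /=; rewrite einvK.
Qed.

Lemma edge_path_rev x p y : edge_path x p y -> edge_path y (rev_path p) x.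
Proof.
elim: p x => [|e p ih] x /= => [/eqP->//|/andP[/eqP <- /ih h]].
rewrite /rev_path /= rev_cons -cats1; apply: (cat_edge_path h) => /=.
by rewrite src_einv tgt_einv !eqxx.
Qed.

Section BasePoint.
Variable x : vertex.

Record loop := Loop { loop_path :> seq edge; _ : edge_path x loop_path x }.

HB.instance Definition _ := [isSub for loop_path].
HB.instance Definition _ := [Choice of loop by <:].

Lemma loopP (l : loop) : edge_path x l x. Proof. by case: l. Qed.

(* Removing a backtrack, or pushing a subpath across a square: with coordinates
   (s, t) on the square, both sides go from (0, 0) to (1, 1), the first through
   (1, 0) and the second through (0, 1). Note that all loops here are genuine
   edge paths, by typing. *)
Inductive homotopy_step : loop -> loop -> Prop :=
| HomotopyBacktrack (l l' : loop) (p q : seq edge) (e : edge) :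
    loop_path l = p ++ q -> loop_path l' = p ++ [:: e; einv e] ++ q ->
    homotopy_step l l'
| HomotopySquare (l l' : loop) (p q : seq edge) (s : square) :
    loop_path l = p ++ [:: face ord_max false s; face ord0 true s] ++ q ->
    loop_path l' = p ++ [:: face ord0 false s; face ord_max true s] ++ q ->
    homotopy_step l l'.

Definition loop1 : loop := @Loop [::] (eqxx x).
Definition loop_mul (l m : loop) : loop :=
  Loop (cat_edge_path (loopP l) (loopP m)).
Definition loop_inv (l : loop) : loop := Loop (edge_path_rev (loopP l)).

Lemma loop_mulA : associative loop_mul.
Proof. by move=> l m n; apply: val_inj; rewrite /= catA. Qed.

Lemma loop_mul1 : left_id loop1 loop_mul.
Proof. by move=> l; apply: val_inj. Qed.

Lemma loop_mulr1 : right_id loop1 loop_mul.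
Proof. by move=> l; apply: val_inj; rewrite /= cats0. Qed.

Lemma homotopy_stepl z l l' :
  homotopy_step l l' -> homotopy_step (loop_mul z l) (loop_mul z l').
Proof.
case=> {l l'} l l' p q c el el'.
  by apply: (@HomotopyBacktrack _ _ (z ++ p) q c); rewrite /= -?catA (el, el').
by apply: (@HomotopySquare _ _ (z ++ p) q c); rewrite /= -?catA (el, el').
Qed.

Lemma homotopy_stepr z l l' :
  homotopy_step l l' -> homotopy_step (loop_mul l z) (loop_mul l' z).
Proof.
case=> {l l'} l l' p q c el el'.
  by apply: (@HomotopyBacktrack _ _ p (q ++ z) c); rewrite /= ?(el, el') -?catA.
by apply: (@HomotopySquare _ _ p (q ++ z) c); rewrite /= ?(el, el') -?catA.
Qed.

Lemma loop_mulV l :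
  clos_refl_sym_trans loop homotopy_step (loop_mul l (loop_inv l)) loop1.
Proof.
suff h p y (px : edge_path x p y) (m : loop) :
    loop_path m = p ++ rev_path p -> clos_refl_sym_trans loop homotopy_step m loop1.
  exact: (h l x (loopP l)).
elim/last_ind: p y px m => [|p e ih] y px m em.
  have -> : m = loop1 by apply: val_inj.
  exact: rst_refl.
have [z pz _] : exists2 z, edge_path x p z & edge_path z [:: e] y.
  by apply: edge_path_cat; rewrite cats1.
pose m' := Loop (cat_edge_path pz (edge_path_rev pz)).
apply: rst_trans (ih z pz m' (erefl _)).
apply: rst_sym; apply: rst_step.
apply: (@HomotopyBacktrack _ _ p (rev_path p) e) => //.
by rewrite em /rev_path map_rcons rev_rcons cat_rcons.
Qed.

Lemma loop_mulVl l :
  clos_refl_sym_trans loop homotopy_step (loop_mul (loop_inv l) l) loop1.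
Proof.
have {2}-> : l = loop_inv (loop_inv l).
  by apply: val_inj; rewrite /= rev_pathK.
exact: loop_mulV.
Qed.

Definition loop_groupData : groupData :=
  @GroupData loop loop_mul loop1 loop_inv homotopy_step
    loop_mulA loop_mul1 loop_mulr1 homotopy_stepl homotopy_stepr
    loop_mulV loop_mulVl.

(* Only cubes of dimension at most 2 matter: the fundamental group of a cube
   complex is that of its 2-skeleton, and is computed by edge loops. *)
Definition fundamental_group : groupType := quotGroup loop_groupData.

End BasePoint.
End FundamentalGroup.

Record semigroup_presentation := SemigroupPresentation {
  letter : choiceType;
  defrel : rel (seq letter);
  defrel_nonempty : forall u v, defrel u v -> (u != [::]) && (v != [::])
}.

Section SquierComplex.
Variable P : semigroup_presentation.

(* The empty word is allowed: it is an isolated vertex of the complex. *)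
Definition word := seq (letter P).

(* [(a, (u, v))] stands for the fragment a, u -> v of a cube. *)
Definition move : Type := word * (word * word).
HB.instance Definition _ := Choice.on move.

Definition move_ok (m : move) : bool :=
  defrel m.2.1 m.2.2 || defrel m.2.2 m.2.1.

Definition swap_move (m : move) : move := (m.1, (m.2.2, m.2.1)).

(* The pair [(ms, b)], where ms lists a_1, u_1 -> v_1, ..., a_n, u_n -> v_n and
   b = a_(n+1), is the oriented n-cube
   (a_1, u_1 -> v_1, ..., a_n, u_n -> v_n, a_(n+1)). *)
Definition precube : Type := seq move * word.
HB.instance Definition _ := Choice.on precube.

Record squier_cube (n : nat) := SquierCube {
  precube_of :> precube;
  _ : (size precube_of.1 == n) && all move_ok precube_of.1
}.

HB.instance Definition _ n := [isSub for @precube_of n].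
HB.instance Definition _ n := [Choice of squier_cube n by <:].

(* Replaces a_i, u_i -> v_i, a_(i+1) with a_i w a_(i+1), where w is u_i or v_i. *)
Fixpoint precube_face (i : nat) (e : bool) (ms : seq move) (b : word) : precube :=
  match ms, i with
  | [::], _ => ([::], b)
  | m :: ms', 0 =>
      let w := m.1 ++ (if e then m.2.2 else m.2.1) in
      if ms' is m' :: ms'' then ((w ++ m'.1, m'.2) :: ms'', b)
      else ([::], w ++ b)
  | m :: ms', i'.+1 =>
      let c := precube_face i' e ms' b in (m :: c.1, c.2)
  end.

Fixpoint flip_moves (i : nat) (ms : seq move) : seq move :=
  match ms, i with
  | [::], _ => [::]
  | m :: ms', 0 => swap_move m :: ms'
  | m :: ms', i'.+1 => m :: flip_moves i' ms'
  end.

Lemma precube_face_ok n (i : 'I_n.+1) e (c : squier_cube n.+1) :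
  let c' := precube_face i e (precube_of c).1 (precube_of c).2 in
  (size c'.1 == n) && all move_ok c'.1.
Proof.
case: c i => -[ms b] /= h [i /= lti].
elim: ms i n lti h => [|m ms ih] [|i] [|n] //= lti /andP[sz /andP[mok msok]].
- by case: ms {ih} sz msok.
- case: ms {ih} sz msok => //= m' ms; rewrite eqSS => sz msok; rewrite sz.
  exact: msok.
- by rewrite eqSS mok /=; apply: ih; rewrite // -eqSS sz.
Qed.

Lemma flip_moves_ok n i (c : squier_cube n) :
  let ms := flip_moves i (precube_of c).1 in (size ms == n) && all move_ok ms.
Proof.
case: c => -[ms b] /=.
elim: ms i n => [|m ms ih] [|i] [|n] //= /andP[sz /andP[mok msok]].
  by rewrite sz msok andbT /= /move_ok orbC.
by rewrite eqSS mok /=; apply: ih; rewrite -eqSS sz.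
Qed.

Definition squier_face n (i : 'I_n.+1) e (c : squier_cube n.+1) : squier_cube n :=
  SquierCube (precube_face_ok i e c).

Definition squier_flip n (i : 'I_n) (c : squier_cube n) : squier_cube n :=
  @SquierCube n (flip_moves i (precube_of c).1, (precube_of c).2)
    (flip_moves_ok i c).

Lemma precube_face_face (i j : nat) (d e : bool) (ms : seq move) (b : word) :
  i <= j -> j.+1 < size ms ->
  let c := precube_face j.+1 e ms b in
  let c' := precube_face i d ms b in
  precube_face i d c.1 c.2 = precube_face j e c'.1 c'.2.
Proof.
elim: ms i j => [|m ms ih] [|i] [|j] //=.
- by case: ms {ih} => [|m' [|m'' ms]] //= _ _; rewrite -!catA.
- by case: ms {ih} => [|m' ms].
- by move=> leij lt; rewrite (ih i j).
Qed.

Lemma squier_face_face n (i j : 'I_n.+1) (d e : bool) (c : squier_cube n.+2) :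
  i <= j ->
  squier_face i d (squier_face (lift ord0 j) e c) =
  squier_face j e (squier_face (widen_ord (leqnSn n.+1) i) d c).
Proof.
move=> leij; apply: val_inj; apply: precube_face_face => //.
by case: c => c /= /andP[/eqP -> _]; rewrite ltnS; exact: ltn_ord.
Qed.

Lemma precube_face_flip (i : nat) (e : bool) (ms : seq move) (b : word) :
  precube_face i e (flip_moves i ms) b = precube_face i (~~ e) ms b.
Proof.
elim: ms i => [|m ms ih] [|i] //=; first by case: (e).
by rewrite ih.
Qed.

Lemma squier_face_flip n (i : 'I_n.+1) (e : bool) (c : squier_cube n.+1) :
  squier_face i e (squier_flip i c) = squier_face i (~~ e) c.
Proof. by apply: val_inj; apply: precube_face_flip. Qed.

Lemma precube_face_flip_bump (i j : nat) (e : bool) (ms : seq move) (b : word) :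
  let c := precube_face i e ms b in
  precube_face i e (flip_moves (bump i j) ms) b = (flip_moves j c.1, c.2).
Proof.
elim: ms i j => [|m ms ih] i j; first by case: (bump i j); case: i; case: j.
case: i j => [|i] [|j] //=.
- by case: ms {ih} => [|m' ms].
- by case: ms {ih} => [|m' ms].
- by rewrite bumpS /= ih.
Qed.

Lemma squier_face_flip_lift n (i : 'I_n.+1) (j : 'I_n) (e : bool)
    (c : squier_cube n.+1) :
  squier_face i e (squier_flip (lift i j) c) = squier_flip j (squier_face i e c).
Proof. by apply: val_inj; apply: precube_face_flip_bump. Qed.

Lemma squier_flipK n (i : 'I_n) (c : squier_cube n) :
  squier_flip i (squier_flip i c) = c.
Proof.
apply: val_inj; case: c i => -[ms b] /= h [i /= _]; congr (_, _).
elim: ms i {h} => [|[a [u v]] ms ih] [|i] //=.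
by rewrite ih.
Qed.

Lemma squier_flipC n (i j : 'I_n) (c : squier_cube n) :
  squier_flip i (squier_flip j c) = squier_flip j (squier_flip i c).
Proof.
apply: val_inj; case: c i j => -[ms b] /= h [i /= _] [j /= _]; congr (_, _).
elim: ms i j {h} => [|m ms ih] [|i] [|j] //=.
by rewrite ih.
Qed.

Definition squier_complex : cubeComplex :=
  CubeComplex squier_face_face squier_face_flip squier_face_flip_lift
    squier_flipK squier_flipC.

Definition squier_vertex (w : word) : vertex squier_complex :=
  @SquierCube 0 ([::], w) isT.

(* An edge path from w never leaves the connected component S(P, w), so that
   S(P, w) and S(P) have the same fundamental group at w. *)
Definition diagram_group (w : word) : groupType :=
  fundamental_group (squier_vertex w).

End SquierComplex.

(* Here {1, ..., n} is represented by 'I_n = {0, ..., n - 1}. *)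
Definition is_interval n (I : {set 'I_n}) : bool :=
  (I != set0) &&
  [forall i in I, forall j in I, forall k : 'I_n, (i <= k <= j) ==> (k \in I)].

Record interval (n : nat) := Interval {
  interval_set :> {set 'I_n};
  _ : is_interval interval_set
}.

HB.instance Definition _ n := [isSub for @interval_set n].
HB.instance Definition _ n := [Finite of interval n by <:].

Section IntervalCollection.
Variables (n : nat) (C : {set interval n}).

Definition member := {I : interval n | I \in C}.

Definition intersect_edge : rel member := fun I J =>
  (I != J) && ((val I :&: val J : {set 'I_n}) != set0).

Lemma intersect_edge_sym : symmetric intersect_edge.
Proof. by move=> I J; rewrite /intersect_edge eq_sym setIC. Qed.

Lemma intersect_edge_irr : irreflexive intersect_edge.
Proof. by move=> I; rewrite /intersect_edge eqxx. Qed.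

Definition interval_graph : sgraph :=
  SGraph intersect_edge_sym intersect_edge_irr.

(* The letters x_1, ..., x_n and a_I, b_I, c_I for I in C. *)
Inductive gen :=
| x_ of 'I_n
| a_ of member
| b_ of member
| c_ of member.

Definition gen_code (g : gen) : 'I_n + (member + (member + member)) :=
  match g with
  | x_ i => inl i
  | a_ J => inr (inl J)
  | b_ J => inr (inr (inl J))
  | c_ J => inr (inr (inr J))
  end.

Definition gen_decode (s : 'I_n + (member + (member + member))) : gen :=
  match s with
  | inl i => x_ i
  | inr (inl J) => a_ J
  | inr (inr (inl J)) => b_ J
  | inr (inr (inr J)) => c_ J
  end.

Lemma gen_codeK : cancel gen_code gen_decode.
Proof. by case. Qed.

HB.instance Definition _ := Finite.copy gen (can_type gen_codeK).

(* [enum] lists the elements of a set of ordinals in increasing order. *)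
Definition xword (I : {set 'I_n}) : seq gen := [seq x_ i | i <- enum I].

Definition interval_rel : rel (seq gen) := fun u v =>
  [exists I : member, (u, v) \in
    [:: (xword (val I), [:: a_ I]); ([:: a_ I], [:: b_ I]);
        ([:: b_ I], [:: c_ I]); ([:: c_ I], [:: a_ I])]].

Lemma interval_rel_nonempty u v :
  interval_rel u v -> (u != [::]) && (v != [::]).
Proof.
case/existsP=> J; have /andP[/set0Pn[i iJ] _] := valP (val J).
rewrite !inE; case/or4P=> /eqP[-> ->] //=; rewrite andbT.
rewrite -size_eq0 size_map -cardE; apply/eqP => /card0_eq /(_ i).
by rewrite iJ.
Qed.

Definition interval_presentation : semigroup_presentation :=
  SemigroupPresentation interval_rel_nonempty.

End IntervalCollection.

(* Main.v *)
(* Let [expand w] be the word obtained from [w] by replacing each letter a_I, b_I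
   or c_I with x_I; it is constant on the connected components of the Squier
   complex. A word [w] is reached from [expand w] by the canonical path that
   rewrites each letter separately, following x_I -> a_I -> b_I -> c_I. Label an
   edge c_I -> a_I with the generator I, and all the positive edges of the other
   kinds trivially. Reading labels sends loops to words in the generators of the
   Artin group; it is invariant under homotopy because the two moves of a square
   over x_1 ... x_n involve disjoint intervals. Conversely, send I to the triangle
   loop x_I -> a_I -> b_I -> c_I -> a_I -> x_I performed inside x_1 ... x_n.
   Disjoint moves can be exchanged across squares, so that an edge with label g
   appended to a canonical path is homotopic to the loop of g followed by a
   canonical path. Hence every loop is homotopic to the loop of its label. *)

Require Import Defs.
From mathcomp Require Import all_boot.
From HB Require Import structures.
From mathcomp Require Import generic_quotient.
From Stdlib Require Import Relation_Operators.

Set Implicit Arguments.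
Unset Strict Implicit.
Unset Printing Implicit Defensive.

Local Open Scope quotient_scope.

Local Notation crst G := (clos_refl_sym_trans (gdsort G) (@gdstep G)).

(** * Isomorphisms of quotient groups from maps on representatives *)

Lemma pi_crst (G : groupData) (x y : G) :
  crst G x y -> \pi_(quotGroup G) x = \pi_(quotGroup G) y.
Proof. by move=> xy; apply/eqP/quot_eqP. Qed.

Lemma crst_pi (G : groupData) (x y : G) :
  \pi_(quotGroup G) x = \pi_(quotGroup G) y -> crst G x y.
Proof. by move/eqP/quot_eqP. Qed.

Section QuotientIso.
Variables (G H : groupData) (f : G -> H) (g : H -> G).
Hypothesis fM : {morph f : x y / gdmul x y >-> gdmul x y}.
Hypothesis f_step : forall x y, gdstep x y -> crst H (f x) (f y).
Hypothesis g_step : forall x y, gdstep x y -> crst G (g x) (g y).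
Hypothesis fK : forall x, crst G (g (f x)) x.
Hypothesis gK : forall y, crst H (f (g y)) y.

Lemma crst_homo (A B : groupData) (h : A -> B) :
  (forall x y, gdstep x y -> crst B (h x) (h y)) ->
  forall x y, crst A x y -> crst B (h x) (h y).
Proof.
move=> h_step x y; elim=> {x y} [x y /h_step //|x|x y _|x y z _ hxy _].
- exact: rst_refl.
- exact: rst_sym.
- exact: rst_trans hxy.
Qed.

Definition quot_map (x : quotGroup G) : quotGroup H := \pi_(quotGroup H) (f (repr x)).

Lemma quot_mapE x : quot_map (\pi_(quotGroup G) x) = \pi_(quotGroup H) (f x).
Proof. by apply/pi_crst/crst_homo/repr_crst. Qed.

Lemma quot_mapM : {morph quot_map : x y / (x * y)%g}.
Proof.
move=> x y; elim/quotW: x => x; elim/quotW: y => y.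
have mulE (A : groupData) (a b : quotGroup A) : (a * b)%g = quot_mul a b by [].
by rewrite !mulE quot_mulE !quot_mapE quot_mulE fM.
Qed.

HB.instance Definition _ :=
  isMultiplicative.Build (quotGroup G) (quotGroup H) quot_map quot_mapM.

(** Multiplicativity is asked of [f] on representatives. The map [g] only has to respect the steps
    and to invert [f] up to equivalence, since it supplies the set-theoretic inverse. *)
Lemma quotGroup_iso : isomorphic_groups (quotGroup G) (quotGroup H).
Proof.
exists quot_map, (fun y => \pi_(quotGroup G) (g (repr y))) => [x|y] /=.
  elim/quotW: x => x; rewrite quot_mapE; apply/pi_crst.
  exact: rst_trans (crst_homo g_step (repr_crst _)) (fK x).
rewrite quot_mapE -[RHS]reprK; apply/pi_crst; exact: gK.
Qed.

End QuotientIso.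

(** * Homotopy of edge paths *)

Section PathHomotopy.
Variable K : cubeComplex.

(** The moves of [homotopy_step] on bare edge sequences, so that they also apply to open paths, such
    as the canonical ones. Endpoints come back in [path_homotopy], where every intermediate sequence
    must be an edge path. *)
Inductive elementary_homotopy : seq (edge K) -> seq (edge K) -> Prop :=
| Backtrack p q e : elementary_homotopy (p ++ q) (p ++ [:: e; einv e] ++ q)
| SquareMove p q (s : square K) : elementary_homotopy
    (p ++ [:: face ord_max false s; face ord0 true s] ++ q)
    (p ++ [:: face ord0 false s; face ord_max true s] ++ q).

Inductive path_homotopy (x y : vertex K) : seq (edge K) -> seq (edge K) -> Prop :=
| ph_refl p : edge_path x p y -> path_homotopy x y p p
| ph_step p q : edge_path x p y -> edge_path x q y -> elementary_homotopy p q ->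
    path_homotopy x y p q
| ph_sym p q : path_homotopy x y p q -> path_homotopy x y q p
| ph_trans q p r : path_homotopy x y p q -> path_homotopy x y q r ->
    path_homotopy x y p r.

Lemma ph_path x y p q :
  path_homotopy x y p q -> edge_path x p y /\ edge_path x q y.
Proof. by elim=> {p q} [| |p q _ []|q p r _ [? ?] _ []]. Qed.

Lemma elementary_homotopy_ctx a b p q : elementary_homotopy p q ->
  elementary_homotopy (a ++ p ++ b) (a ++ q ++ b).
Proof. by case=> {p q} *; rewrite -!catA !(catA a); constructor. Qed.

Lemma ph_ctx x y z t a b p q : edge_path x a y -> edge_path z b t ->
  path_homotopy y z p q -> path_homotopy x t (a ++ p ++ b) (a ++ q ++ b).
Proof.
move=> pa pb; elim=> {p q} [p pp|p q pp pq pq'|p q _|q p r _ h1 _ h2].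
- by apply: ph_refl; apply: cat_edge_path pa (cat_edge_path pp pb).
- apply: ph_step; last exact: elementary_homotopy_ctx.
    exact: cat_edge_path pa (cat_edge_path pp pb).
  exact: cat_edge_path pa (cat_edge_path pq pb).
- exact: ph_sym.
- exact: ph_trans h1 h2.
Qed.

Lemma ph_cat x y z p p' q q' : path_homotopy x y p p' ->
  path_homotopy y z q q' -> path_homotopy x z (p ++ q) (p' ++ q').
Proof.
move=> hp hq; have [pp pp'] := ph_path hp; have [pq pq'] := ph_path hq.
apply: (@ph_trans _ _ (p' ++ q)).
  by apply: (@ph_ctx x x y z [::] q) => //=.
by have := ph_ctx pp' (eqxx z : edge_path z [::] z) hq; rewrite !cats0.
Qed.

Lemma ph_rev x y p : edge_path x p y -> path_homotopy x x (p ++ Defs.rev_path p) [::].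
Proof.
elim/last_ind: p y => [|p e ih] y pp; first exact/ph_refl/eqxx.
have [z pz ez] : exists2 z, edge_path x p z & edge_path z [:: e] y.
  by apply: edge_path_cat; rewrite cats1.
apply: ph_trans (ih z pz); apply: ph_sym; apply: ph_step.
- exact: cat_edge_path pz (edge_path_rev pz).
- exact: cat_edge_path pp (edge_path_rev pp).
- by rewrite -cats1 -catA /Defs.rev_path map_cat rev_cat /= -map_rev; constructor.
Qed.

Lemma ph_revl x y p : edge_path x p y -> path_homotopy y y (Defs.rev_path p ++ p) [::].
Proof. by move/edge_path_rev/ph_rev; rewrite rev_pathK. Qed.

Lemma ph_loop x p q : path_homotopy x x p q -> forall l l' : loop x,
  loop_path l = p -> loop_path l' = q ->
  clos_refl_sym_trans _ (@homotopy_step K x) l l'.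
Proof.
elim=> {p q} [p _|p q _ _ pq|p q _ ih|q p r hpq ih1 _ ih2] l l' el el'.
- have -> : l = l' by apply: val_inj; rewrite /= el el'.
  exact: rst_refl.
- apply: rst_step; case: pq el el' => {p q} p q c el el'.
    exact: HomotopyBacktrack el el'.
  exact: HomotopySquare el el'.
- exact/rst_sym/ih.
- have [_ pq] := ph_path hpq.
  exact: rst_trans (ih1 l (Loop pq) el erefl) (ih2 (Loop pq) l' erefl el').
Qed.

End PathHomotopy.

(** * Whiskering and the exchange law in Squier complexes *)

Section Whiskering.
Variable P : semigroup_presentation.
Local Notation word := (word P).

(* Concatenation with a on the left and b on the right. The leftmost word of a cube
   is stored in its first move, if there is one. *)
Definition whisker_precube (a b : word) (c : precube P) : precube P :=
  if c.1 is m :: ms then ((a ++ m.1, m.2) :: ms, c.2 ++ b)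
  else ([::], a ++ c.2 ++ b).

Lemma whisker_precube_ok n a b (c : squier_cube P n) :
  let c' := whisker_precube a b c in (size c'.1 == n) && all (@move_ok P) c'.1.
Proof. by case: c => -[[|m ms] c]. Qed.

Definition whisker n a b (c : squier_cube P n) : squier_cube P n :=
  SquierCube (whisker_precube_ok a b c).

Lemma precube_face_catr i e ms (c b : word) :
  let d := precube_face i e ms c in
  precube_face i e ms (c ++ b) = (d.1, d.2 ++ b).
Proof.
elim: ms i => [|m ms ih] [|i] //=; last by rewrite ih.
by case: ms {ih} => [|m' ms] //=; rewrite -!catA.
Qed.

Lemma precube_face_whisker a b i e (c : precube P) : i < size c.1 ->
  let c' := whisker_precube a b c in
  precube_face i e c'.1 c'.2 = whisker_precube a b (precube_face i e c.1 c.2).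
Proof.
case: c => -[|m ms] c //= lti; rewrite precube_face_catr.
case: i lti => [|i] /= lti; last by [].
by case: ms {lti} => [|m' ms]; rewrite /whisker_precube /= -?catA.
Qed.

Lemma face_whisker n (i : 'I_n.+1) e a b (c : squier_cube P n.+1) :
  squier_face i e (whisker a b c) = whisker a b (squier_face i e c).
Proof.
apply: val_inj; apply: precube_face_whisker.
by case: c => c /= /andP[/eqP -> _].
Qed.

Lemma flip_whisker n (i : 'I_n) a b (c : squier_cube P n) :
  squier_flip i (whisker a b c) = whisker a b (squier_flip i c).
Proof. by apply: val_inj; case: c i => -[[|m ms] c] h [[|i] lti]. Qed.

Lemma whisker_whisker n a b a' b' (c : squier_cube P n) :
  whisker a b (whisker a' b' c) = whisker (a ++ a') (b' ++ b) c.
Proof.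
apply: val_inj; case: c => -[[|m ms] c] h /=;
by rewrite /whisker_precube /= -!catA.
Qed.

Lemma whisker_nil n (c : squier_cube P n) : whisker [::] [::] c = c.
Proof.
apply: val_inj; case: c => -[[|[m1 m2] ms] c] h /=;
by rewrite /whisker_precube /= ?cats0.
Qed.

Local Notation sqedge := (edge (squier_complex P)).

Definition whisker_path (a b : word) (p : seq sqedge) : seq sqedge :=
  map (@whisker 1 a b) p.

Definition word_path (u : word) (p : seq sqedge) (v : word) : bool :=
  @edge_path (squier_complex P) (squier_vertex u) p (squier_vertex v).

Definition word_homotopy (u v : word) (p q : seq sqedge) : Prop :=
  @path_homotopy (squier_complex P) (squier_vertex u) (squier_vertex v) p q.

Lemma squier_vertex_inj : injective (@squier_vertex P).
Proof. by move=> u v /(congr1 (fun c => (precube_of c).2)). Qed.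

Lemma squier_vertexP (c : squier_cube P 0) : exists w, c = squier_vertex w.
Proof. by case: c => -[[|//] w] h; exists w; apply: val_inj. Qed.

Lemma whisker_vertex a b w :
  whisker a b (squier_vertex w) = squier_vertex (a ++ w ++ b).
Proof. exact: val_inj. Qed.

Lemma whisker_pathM a b a' b' p :
  whisker_path a b (whisker_path a' b' p) = whisker_path (a ++ a') (b' ++ b) p.
Proof.
by rewrite /whisker_path -map_comp; apply: eq_map => e; apply: whisker_whisker.
Qed.

Lemma whisker_path_nil p : whisker_path [::] [::] p = p.
Proof. by rewrite /whisker_path -[RHS]map_id; apply/eq_map/whisker_nil. Qed.

Lemma whisker_path_cat a b p q :
  whisker_path a b (p ++ q) = whisker_path a b p ++ whisker_path a b q.
Proof. exact: map_cat. Qed.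

Lemma whisker_einv a b (e : sqedge) :
  whisker a b (einv e) = @einv (squier_complex P) (whisker a b e).
Proof. exact/esym/flip_whisker. Qed.

Lemma whisker_rev_path a b p :
  whisker_path a b (Defs.rev_path p) = Defs.rev_path (whisker_path a b p).
Proof.
rewrite /whisker_path /Defs.rev_path map_rev -!map_comp; congr rev.
by apply: eq_map => e /=; rewrite [RHS]flip_whisker.
Qed.

Lemma word_path_whisker a b u p v :
  word_path u p v -> word_path (a ++ u ++ b) (whisker_path a b p) (a ++ v ++ b).
Proof.
rewrite /word_path -!whisker_vertex.
elim: p (squier_vertex u) => [|e p ih] x /=; first by move/eqP->.
case/andP=> /eqP <- /ih; rewrite /src /tgt /= => h.
by rewrite !face_whisker eqxx.
Qed.

Lemma word_homotopy_whisker a b u v p q : word_homotopy u v p q ->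
  word_homotopy (a ++ u ++ b) (a ++ v ++ b) (whisker_path a b p) (whisker_path a b q).
Proof.
elim=> {p q} [p pp|p q pp pq pq'|p q _|q p r _ h1 _ h2].
- exact/ph_refl/word_path_whisker.
- apply: ph_step; try exact: word_path_whisker.
  case: pq' {pp pq} => {}p {}q c; rewrite !whisker_path_cat.
    rewrite [whisker_path _ _ [:: _; _]]/= whisker_einv.
    exact: Backtrack.
  by rewrite /= -!face_whisker; apply: (@SquareMove (squier_complex P)).
- exact: ph_sym.
- exact: ph_trans h1 h2.
Qed.

Definition valid_move (u v : word) := defrel u v || defrel v u.

Lemma move_edge_ok u v : valid_move u v ->
  (size [:: ([::] : word, (u, v))] == 1) && all (@move_ok P) [:: ([::], (u, v))].
Proof. by move=> h; rewrite /= andbT. Qed.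

Definition move_edge u v (h : valid_move u v) : sqedge :=
  @SquierCube P 1 ([:: ([::], (u, v))], [::]) (move_edge_ok h).

Lemma word_path_move u v (h : valid_move u v) : word_path u [:: move_edge h] v.
Proof.
by apply/andP; split; apply/eqP/val_inj; rewrite /= cats0.
Qed.

Lemma squier_edgeP (e : sqedge) :
  exists a b u v (h : valid_move u v), e = whisker a b (move_edge h).
Proof.
case: e => -[[|[a [u v]] [|? ?]] b] //= h.
have uv : valid_move u v by move: h; rewrite /= andbT.
by exists a, b, u, v, uv; apply: val_inj; rewrite /= /whisker_precube /= cats0.
Qed.

Lemma word_path_moveP u v a b s t (h : valid_move s t) :
  word_path u [:: whisker a b (move_edge h)] v ->
  u = a ++ s ++ b /\ v = a ++ t ++ b.
Proof.
case/andP=> /eqP hu /eqP hv.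
split; apply: squier_vertex_inj; [rewrite -hu | rewrite -hv];
by apply: val_inj; rewrite /= /whisker_precube /= -!catA ?cats0.
Qed.

(** The two sides are the two ways around a single square of the Squier complex. *)
Lemma exchange_edge u u' v v' e f :
  word_path u [:: e] u' -> word_path v [:: f] v' ->
  word_homotopy (u ++ v) (u' ++ v')
    (whisker_path [::] v [:: e] ++ whisker_path u' [::] [:: f])
    (whisker_path u [::] [:: f] ++ whisker_path [::] v' [:: e]).
Proof.
move=> he hf; apply: ph_step.
- apply: cat_edge_path; first exact: (word_path_whisker [::] v he).
  by have := word_path_whisker u' [::] hf; rewrite !cats0.
- apply: (@cat_edge_path _ _ (squier_vertex (u ++ v'))).
    by have := word_path_whisker u [::] hf; rewrite !cats0.
  exact: (word_path_whisker [::] v' he).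
have [a [b [s [s' [hs ee]]]]] := squier_edgeP e.
have [c [d [t [t' [ht ff]]]]] := squier_edgeP f.
rewrite {}ee {}ff in he hf *.
have [-> ->] := word_path_moveP he; have [-> ->] := word_path_moveP hf.
(* In this square, the right context [b] of the first move and the left context [c] of the second
   merge into the middle word. *)
have h : let ms := [:: (a, (s, s')); (b ++ c, (t, t'))] in
    (size ms == 2) && all (@move_ok P) ms.
  by move: (hs) (ht); rewrite /valid_move /move_ok /= => -> ->.
(* The sides of the square match the whiskered edges only up to associativity of concatenation,
   hence this transport. *)
have ehE p p' q q' : p = p' -> q = q' ->
    @elementary_homotopy (squier_complex P) p q -> elementary_homotopy p' q'.
  by move=> -> ->.
apply: (ehE _ _ _ _ _ _ (@SquareMove (squier_complex P) [::] [::]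
  (@SquierCube P 2 (_, d) h)));
  congr [:: _; _]; apply: val_inj;
  by rewrite /= /whisker_precube /= ?cats0 -?catA.
Qed.

Lemma word_path_cons u e p w : word_path u (e :: p) w ->
  exists2 v, word_path u [:: e] v & word_path v p w.
Proof.
rewrite /word_path /= => /andP[-> h].
have [v ev] := squier_vertexP (tgt e); exists v; rewrite -?ev //=.
Qed.

Lemma word_path_lwhisker a u p v :
  word_path u p v -> word_path (a ++ u) (whisker_path a [::] p) (a ++ v).
Proof. by move/(word_path_whisker a [::]); rewrite !cats0. Qed.

Lemma word_path_rwhisker b u p v :
  word_path u p v -> word_path (u ++ b) (whisker_path [::] b p) (v ++ b).
Proof. exact: (word_path_whisker [::] b). Qed.

Lemma wh_refl u p v : word_path u p v -> word_homotopy u v p p.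
Proof. exact: ph_refl. Qed.

Lemma exchange_edge_path u u' v v' e q :
  word_path u [:: e] u' -> word_path v q v' ->
  word_homotopy (u ++ v) (u' ++ v')
    (whisker_path [::] v [:: e] ++ whisker_path u' [::] q)
    (whisker_path u [::] q ++ whisker_path [::] v' [:: e]).
Proof.
move=> he; elim: q v => [|f q ih] v.
  move/eqP/squier_vertex_inj->.
  exact/wh_refl/(word_path_whisker [::] v' he).
case/word_path_cons=> w hf hq.
apply: (@ph_trans _ _ _ (whisker_path u [::] [:: f] ++
    whisker_path [::] w [:: e] ++ whisker_path u' [::] q)).
  exact: ph_cat (exchange_edge he hf) (wh_refl (word_path_lwhisker u' hq)).
exact: ph_cat (wh_refl (word_path_lwhisker u hf)) (ih w hq).
Qed.

(** A grid of squares lies between the two sides: [exchange_edge_path] fills one row, and the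
    induction on [p] stacks the rows. *)
Lemma exchange u u' v v' p q : word_path u p u' -> word_path v q v' ->
  word_homotopy (u ++ v) (u' ++ v')
    (whisker_path [::] v p ++ whisker_path u' [::] q)
    (whisker_path u [::] q ++ whisker_path [::] v' p).
Proof.
move=> + hq; elim: p u => [|e p ih] u.
  move/eqP/squier_vertex_inj->; rewrite cats0.
  exact/wh_refl/word_path_lwhisker.
case/word_path_cons=> w he hp.
apply: (@ph_trans _ _ _ (whisker_path [::] v [:: e] ++
    whisker_path w [::] q ++ whisker_path [::] v' p)).
  exact: ph_cat (wh_refl (word_path_rwhisker v he)) (ih w hp).
rewrite -[whisker_path _ _ (e :: p)]/(whisker_path [::] v' [:: e] ++ _) !catA.
exact: ph_cat (exchange_edge_path he hq) (wh_refl (word_path_rwhisker v' hp)).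
Qed.

End Whiskering.

(** * Inverting an edge in a homotopy, and factorizations of words *)

Lemma edge_path_inj K (x y y' : vertex K) p :
  edge_path x p y -> edge_path x p y' -> y = y'.
Proof.
elim: p x => [|e p ih] x /= => [/eqP-> /eqP //|/andP[_ h] /andP[_ h']].
exact: ih h h'.
Qed.

(** Insert [w] preceded by its reverse in front of [q], replace [w ++ q] by [p ++ [:: e]], and
    cancel [e] with its inverse. This turns the relation for a move into the one for the opposite
    move. *)
Lemma ph_transfer K (x y z : vertex K) p q w e :
  edge_path x p y -> edge_path x w x -> path_homotopy x z (p ++ [:: e]) (w ++ q) ->
  path_homotopy x y (q ++ [:: einv e]) (Defs.rev_path w ++ p).
Proof.
move=> pp pw h; have [ppe pwq] := ph_path h.
have [y' /(edge_path_inj pp) <- pe] := edge_path_cat ppe.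
have [x' /(edge_path_inj pw) <- pq] := edge_path_cat pwq.
have pei : edge_path z [:: einv e] y := edge_path_rev pe.
have pwi := edge_path_rev pw.
apply: (@ph_trans _ _ _ ((Defs.rev_path w ++ w) ++ q ++ [:: einv e])).
  apply: ph_sym; apply: (@ph_cat _ _ x _ _ [::]); first exact: ph_revl pw.
  exact/ph_refl/(cat_edge_path pq).
apply: (@ph_trans _ _ _ (Defs.rev_path w ++ (p ++ [:: e]) ++ [:: einv e])).
  rewrite -catA; apply: ph_cat (ph_refl pwi) _; rewrite catA.
  exact: ph_cat (ph_sym h) (ph_refl pei).
rewrite -[X in path_homotopy _ _ _ (_ ++ X)]cats0 -!catA.
apply: ph_cat (ph_refl pwi) _; apply: ph_cat (ph_refl pp) _.
exact: ph_rev pe.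
Qed.

(** The first letter of [s] occurs only once, so its index determines the length of the prefix. *)
Lemma uniq_cat_inj (T : eqType) (a a' b b' s : seq T) : s != [::] ->
  uniq (a ++ s ++ b) -> a ++ s ++ b = a' ++ s ++ b' -> a = a' /\ b = b'.
Proof.
case: s => // i s _ ua eab.
have index_i (c d : seq T) : uniq (c ++ (i :: s) ++ d) ->
    index i (c ++ (i :: s) ++ d) = size c.
  rewrite cat_uniq index_cat /= eqxx addn0 => /and3P[_ + _].
  by rewrite negb_or => /andP[/negPf->].
have sa : size a = size a'.
  by rewrite -(index_i a b ua) -(index_i a' b') -eab.
move/eqP: eab; rewrite eqseq_cat // => /andP[/eqP-> ].
by rewrite eqseq_cat // => /andP[_ /eqP->].
Qed.

Lemma cat_split (T : Type) (a b c d : seq T) : a ++ b = c ++ d ->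
  size a <= size c -> exists2 e, c = a ++ e & b = e ++ d.
Proof.
elim: a c => [|x a ih] [|y c] //= => [->|->|[<- /ih h] /h[e -> ->]].
- by exists [::].
- by exists (y :: c).
- by exists e.
Qed.

(** If the first block ran past the start of the second, the first letter of [s2] would belong to
    [s1]. *)
Lemma cat_disjoint_split (T : eqType) (a1 s1 b1 a2 s2 b2 : seq T) :
  s2 != [::] -> {in s1, forall x, x \notin s2} -> size a1 <= size a2 ->
  a1 ++ s1 ++ b1 = a2 ++ s2 ++ b2 ->
  exists2 c, a2 = a1 ++ s1 ++ c & b1 = c ++ s2 ++ b2.
Proof.
move=> n2 dis le12 /cat_split/(_ le12)[c -> e].
have [sc|cs] := leqP (size s1) (size c).
  by have [d -> ->] := cat_split e sc; exists d.
have [d es1 e2] := cat_split (esym e) (ltnW cs).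
case: d es1 e2 => [|x d] es1 e2; first by rewrite es1 cats0 ltnn in cs.
case: s2 n2 dis e2 {e cs} => // y s2 _ + [eyx _].
by move/(_ x); rewrite es1 eyx mem_cat !mem_head orbT => /(_ isT).
Qed.

(** * Canonical paths and labels *)

Section IntervalPresentation.
Variables (n : nat) (C : {set interval n}).
Local Notation P := (interval_presentation C).
Local Notation member := (member C).
Local Notation word := (word P).
Local Notation sqedge := (edge (squier_complex P)).
Local Notation xI I := (xword C (val (I : member))).
Local Notation x0 := (xword C [set: 'I_n]).

Definition gen_expand (g : gen C) : word :=
  match g with x_ i => [:: x_ C i] | a_ J | b_ J | c_ J => xI J end.

Definition expand (w : word) : word := flatten (map gen_expand w).

Lemma expand_cat u v : expand (u ++ v) = expand u ++ expand v.
Proof. by rewrite /expand map_cat flatten_cat. Qed.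

Lemma expand_xword I : expand (xword C I) = xword C I.
Proof. by rewrite /expand /xword; elim: (enum I) => //= i s ->. Qed.

Lemma interval_relP (u v : word) : interval_rel u v -> exists I : member,
  (u, v) \in [:: (xI I, [:: a_ I]); ([:: a_ I], [:: b_ I]);
                 ([:: b_ I], [:: c_ I]); ([:: c_ I], [:: a_ I])].
Proof. by case/existsP=> I h; exists I. Qed.

Lemma expand_move (u v : word) : @valid_move P u v -> expand u = expand v.
Proof.
by case/orP=> /interval_relP[I]; rewrite !inE => /or4P[] /eqP[-> ->];
  rewrite ?expand_xword /expand /= ?cats0.
Qed.

Lemma expand_path u p v : @word_path P u p v -> expand u = expand v.
Proof.
elim: p u => [u /eqP/squier_vertex_inj -> //|e p ih u].
case/word_path_cons=> w he /ih <-.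
have [a [b [s [t [h ee]]]]] := squier_edgeP e; rewrite {}ee in he.
have [-> ->] := word_path_moveP he.
by rewrite !expand_cat (expand_move h).
Qed.

Lemma xa_valid I : @valid_move P (xI I) [:: a_ I].
Proof. by apply/orP; left; apply/existsP; exists I; rewrite !inE eqxx. Qed.

Lemma ab_valid I : @valid_move P [:: a_ I] [:: b_ I].
Proof. by apply/orP; left; apply/existsP; exists I; rewrite !inE eqxx orbT. Qed.

Lemma bc_valid I : @valid_move P [:: b_ I] [:: c_ I].
Proof. by apply/orP; left; apply/existsP; exists I; rewrite !inE eqxx !orbT. Qed.

Lemma ca_valid I : @valid_move P [:: c_ I] [:: a_ I].
Proof. by apply/orP; left; apply/existsP; exists I; rewrite !inE eqxx !orbT. Qed.

Definition gen_path (g : gen C) : seq sqedge :=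
  match g with
  | x_ _ => [::]
  | a_ J => [:: move_edge (xa_valid J)]
  | b_ J => [:: move_edge (xa_valid J); move_edge (ab_valid J)]
  | c_ J => [:: move_edge (xa_valid J); move_edge (ab_valid J);
                move_edge (bc_valid J)]
  end.

(** Letters are rewritten from the last to the first: while the tail is treated, the head is still
    expanded. *)
Fixpoint canonical_path (w : word) : seq sqedge :=
  if w is g :: w' then
    whisker_path (gen_expand g) [::] (canonical_path w') ++
    whisker_path [::] w' (gen_path g)
  else [::].

Lemma word_path_cat (u v w : word) p q :
  @word_path P u p v -> @word_path P v q w -> @word_path P u (p ++ q) w.
Proof. exact: cat_edge_path. Qed.

Lemma word_path_gen g : @word_path P (gen_expand g) (gen_path g) [:: g].
Proof.
have xa I := word_path_move (xa_valid I).
have xb I := word_path_cat (xa I) (word_path_move (ab_valid I)).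
case: g => [i|I|I|I]; [exact: eqxx | exact: xa | exact: xb |].
exact: word_path_cat (xb I) (word_path_move (bc_valid I)).
Qed.

Lemma word_path_canonical w : @word_path P (expand w) (canonical_path w) w.
Proof.
elim: w => [|g w ih] /=; first exact: eqxx.
apply: word_path_cat; first exact: word_path_lwhisker ih.
exact: (word_path_rwhisker w (word_path_gen g)).
Qed.

Lemma canonical_path_cat u v : canonical_path (u ++ v) =
  whisker_path (expand u) [::] (canonical_path v) ++
  whisker_path [::] v (canonical_path u).
Proof.
elim: u => [|g u ih] /=; first by rewrite whisker_path_nil cats0.
rewrite ih !whisker_path_cat !whisker_pathM !cats0 -catA.
by [].
Qed.

Lemma canonical_path_gen g : canonical_path [:: g] = gen_path g.
Proof. by rewrite /= whisker_path_nil. Qed.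

Lemma canonical_path_xword I : canonical_path (xword C I) = [::].
Proof. by rewrite /xword; elim: (enum I) => //= i s ->. Qed.

Definition triangle (I : member) : seq sqedge :=
  [:: move_edge (xa_valid I); move_edge (ab_valid I); move_edge (bc_valid I);
      move_edge (ca_valid I); einv (move_edge (xa_valid I))].

Lemma word_path_triangle I : @word_path P (xI I) (triangle I) (xI I).
Proof.
apply: word_path_cat (word_path_gen (c_ I)) _.
apply: word_path_cat (word_path_move (ca_valid I)) _.
exact: edge_path_rev (word_path_gen (a_ I)).
Qed.

(** The index of [c_] is not inspected: along a valid move it is the same interval as that of
    [a_]. *)
Definition move_label (u v : word) : gword member :=
  match u, v with
  | [:: c_ _], [:: a_ J] => [:: (J, true)]
  | [:: a_ J], [:: c_ _] => [:: (J, false)]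
  | _, _ => [::]
  end.

Lemma move_labelV u v : move_label v u = gword_inv (move_label u v).
Proof. by case: u => [|[] ? [|? ?]] //; case: v => [|[] ? [|? ?]]. Qed.

Definition edge_label (e : sqedge) : gword member :=
  if (precube_of e).1 is m :: _ then move_label m.2.1 m.2.2 else [::].

Definition path_label (p : seq sqedge) : gword member :=
  flatten (map edge_label p).

Lemma path_label_cat p q : path_label (p ++ q) = path_label p ++ path_label q.
Proof. by rewrite /path_label map_cat flatten_cat. Qed.

Lemma move_label_xl I v : move_label (xI I) v = [::].
Proof. by rewrite /xword; case: (enum _) => [|i [|]]. Qed.

Lemma move_label_xr I v : move_label v (xI I) = [::].
Proof. by rewrite move_labelV move_label_xl. Qed.

Lemma move_labelP (u v : word) : @valid_move P u v ->
  move_label u v = [::] \/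
  exists I b, move_label u v = [:: (I, b)] /\ expand u = xI I.
Proof.
case/orP=> /interval_relP[I]; rewrite !inE => /or4P[] /eqP[-> ->];
  rewrite ?move_label_xl ?move_label_xr; try by left.
- by right; exists I, true; rewrite /expand /= cats0.
- by right; exists I, false; rewrite /expand /= cats0.
Qed.

(** These loops are based at [x_I] alone; [generator_loop] puts them inside [x_1 ... x_n]. *)
Definition local_letter (x : member * bool) : seq sqedge :=
  if x.2 then triangle x.1 else Defs.rev_path (triangle x.1).

Definition local_loop (w : gword member) : seq sqedge :=
  flatten (map local_letter w).

Lemma rev_path_cat (K : cubeComplex) (p q : seq (edge K)) :
  Defs.rev_path (p ++ q) = Defs.rev_path q ++ Defs.rev_path p.
Proof. by rewrite /Defs.rev_path map_cat rev_cat. Qed.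

Lemma local_loopV w : local_loop (gword_inv w) = Defs.rev_path (local_loop w).
Proof.
elim: w => [//|[I b] w ih]; rewrite /gword_inv /= rev_cons -cats1.
rewrite /local_loop map_cat flatten_cat -/(local_loop _) ih rev_path_cat /= cats0.
by case: b; rewrite /local_letter //= rev_pathK.
Qed.

Lemma word_path_local (u v : word) : @valid_move P u v ->
  @word_path P (expand u) (local_loop (move_label u v)) (expand u).
Proof.
case/move_labelP=> [->|[I [b [-> ->]]]]; first exact: eqxx.
rewrite /local_loop /= cats0; case: b; first exact: word_path_triangle.
exact: edge_path_rev (word_path_triangle I).
Qed.

Lemma move_edge_irr u v (h h' : @valid_move P u v) : move_edge h = move_edge h'.
Proof. exact: val_inj. Qed.

Lemma einv_move_edge u v (h : @valid_move P u v) (h' : @valid_move P v u) :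
  einv (move_edge h) = move_edge h'.
Proof. exact: val_inj. Qed.

(** This is the case of an edge without context. The moves [x_I -> a_I -> b_I -> c_I] literally
    prolong the canonical path, [c_I -> a_I] closes the triangle, and opposite moves follow by
    [ph_transfer]. *)
Lemma canonical_path_move (u v : word) (h : @valid_move P u v) :
  @word_homotopy P (expand u) v (canonical_path u ++ [:: move_edge h])
    (local_loop (move_label u v) ++ canonical_path v).
Proof.
have pos (s t : word) (st : @valid_move P s t) : interval_rel s t ->
    @word_homotopy P (expand s) t (canonical_path s ++ [:: move_edge st])
      (local_loop (move_label s t) ++ canonical_path t).
  case/interval_relP=> I; rewrite !inE => hst.
  have pst := word_path_cat (word_path_canonical s) (word_path_move st).
  have triv : canonical_path s ++ [:: move_edge st] = canonical_path t ->
      move_label s t = [::] ->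
      @word_homotopy P (expand s) t (canonical_path s ++ [:: move_edge st])
        (local_loop (move_label s t) ++ canonical_path t).
    by move=> e1 ->; rewrite -e1; apply: wh_refl.
  case/or4P: hst st pst triv => /eqP[-> ->] st pst triv.
  - apply: triv; last exact: move_label_xl.
    by rewrite canonical_path_gen canonical_path_xword /= (move_edge_irr _ st).
  - by apply: triv; rewrite // !canonical_path_gen /= (move_edge_irr _ st).
  - by apply: triv; rewrite // !canonical_path_gen /= (move_edge_irr _ st).
  (* The triangle ends with the inverse of [x_I -> a_I], which forms a backtrack with the canonical
     path of [a_I]. *)
  - have -> : expand [:: c_ I] = xI I by rewrite /expand /= cats0.
    rewrite !canonical_path_gen.
    rewrite (move_edge_irr st (ca_valid I)).
    have xa := word_path_gen (a_ I).
    apply: ph_step.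
    + exact: word_path_cat (word_path_gen (c_ I)) (word_path_move _).
    + exact: word_path_cat (word_path_triangle I) xa.
    have := @Backtrack (squier_complex P) (gen_path (c_ I) ++
      [:: move_edge (ca_valid I)]) [::] (einv (move_edge (xa_valid I))).
    by rewrite einvK.
case/orP: (h) => uv; first exact: pos.
have h' : @valid_move P v u by rewrite /valid_move orbC.
have -> : move_label u v = gword_inv (move_label v u) by exact: move_labelV.
rewrite local_loopV -(einv_move_edge h' h) (expand_move h).
apply: ph_transfer; last exact: pos.
  exact: word_path_canonical.
exact: word_path_local.
Qed.

Lemma word_homotopy_trans (u v : word) p q r : @word_homotopy P u v p q ->
  @word_homotopy P u v q r -> @word_homotopy P u v p r.
Proof. exact: ph_trans. Qed.

(** The canonical path of [a ++ u ++ b] treats [b], then [u], then [a]. The edge is moved before the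
    part over [a] ([step1]), exchanged there for a local loop ([step2]), and this loop is moved to
    the front past the part over [b] ([step3]). *)
Lemma canonical_path_edge a b (u v : word) (h : @valid_move P u v) :
  @word_homotopy P (expand (a ++ u ++ b)) (a ++ v ++ b)
    (canonical_path (a ++ u ++ b) ++ [:: whisker a b (move_edge h)])
    (whisker_path (expand a) (expand b) (local_loop (move_label u v)) ++
     canonical_path (a ++ v ++ b)).
Proof.
set e := [:: move_edge h]; set w := local_loop _.
have he : @word_path P u e v := word_path_move h.
have hw : @word_path P (expand u) w (expand u) := word_path_local h.
have euv : expand u = expand v := expand_move h.
have canE s : canonical_path (a ++ s ++ b) =
    whisker_path (expand a ++ expand s) [::] (canonical_path b) ++
    whisker_path (expand a) b (canonical_path s) ++
    whisker_path [::] (s ++ b) (canonical_path a).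
  by rewrite !canonical_path_cat !whisker_path_cat !whisker_pathM !cats0 -catA.
have pb : @word_path P (expand a ++ expand u ++ expand b)
    (whisker_path (expand a ++ expand u) [::] (canonical_path b))
    (expand a ++ expand u ++ b).
  rewrite !catA; exact/word_path_lwhisker/word_path_canonical.
have step1 : @word_homotopy P (expand a ++ u ++ b) (a ++ v ++ b)
    (whisker_path [::] (u ++ b) (canonical_path a) ++ whisker_path a b e)
    (whisker_path (expand a) b e ++ whisker_path [::] (v ++ b) (canonical_path a)).
  have := exchange (word_path_canonical a) he.
  move/(word_homotopy_whisker [::] b).
  by rewrite !whisker_path_cat !whisker_pathM /= -!catA.
have step2 : @word_homotopy P (expand a ++ expand u ++ b) (expand a ++ v ++ b)
    (whisker_path (expand a) b (canonical_path u ++ e))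
    (whisker_path (expand a) b (w ++ canonical_path v)).
  exact/word_homotopy_whisker/canonical_path_move.
have step3 : @word_homotopy P (expand a ++ expand u ++ expand b)
    (expand a ++ expand u ++ b)
    (whisker_path (expand a ++ expand u) [::] (canonical_path b) ++
     whisker_path (expand a) b w)
    (whisker_path (expand a) (expand b) w ++
     whisker_path (expand a ++ expand u) [::] (canonical_path b)).
  have := exchange hw (word_path_canonical b).
  move/(word_homotopy_whisker (expand a) [::])/ph_sym.
  by rewrite /word_homotopy !whisker_path_cat !whisker_pathM !cats0 -?catA.
have pa : @word_path P (expand a ++ v ++ b)
    (whisker_path [::] (v ++ b) (canonical_path a)) (a ++ v ++ b).
  exact: (word_path_rwhisker (v ++ b) (word_path_canonical a)).
have pv : @word_path P (expand a ++ expand v ++ b)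
    (whisker_path (expand a) b (canonical_path v)) (expand a ++ v ++ b).
  exact/word_path_whisker/word_path_canonical.
have pu : @word_path P (expand a ++ expand u ++ b)
    (whisker_path (expand a) b (canonical_path u)) (expand a ++ u ++ b).
  exact/word_path_whisker/word_path_canonical.
rewrite !canE !expand_cat -euv.
have -> : [:: whisker a b (move_edge h)] = whisker_path a b e by [].
rewrite -!catA.
apply: word_homotopy_trans (ph_cat (wh_refl pb) (ph_cat (wh_refl pu) step1)) _.
rewrite [whisker_path (expand a) b (canonical_path u) ++ _]catA.
rewrite -whisker_path_cat.
apply: word_homotopy_trans
  (ph_cat (wh_refl pb) (ph_cat step2 (wh_refl pa))) _.
rewrite whisker_path_cat -!catA !(catA _ (whisker_path (expand a) b w)).
rewrite [X in word_homotopy _ _ _ X]catA.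
apply: ph_cat step3 _; rewrite euv.
exact: wh_refl (word_path_cat pv pa).
Qed.
End IntervalPresentation.

(** * Position of an interval in the increasing enumeration *)

(** Both sides are strictly increasing lists with the same elements, hence equal. *)
Lemma enum_interval n (I : {set 'I_n}) : is_interval I ->
  enum 'I_n = [seq j : 'I_n <- enum 'I_n | [forall i in I, j < i]] ++ enum I ++
              [seq j : 'I_n <- enum 'I_n | [forall i in I, i < j]].
Proof.
case/andP=> /set0Pn[i0 i0I] /forall_inP convI.
pose lt (i j : 'I_n) := i < j.
have lt_trans : transitive lt by move=> j i k; apply: ltn_trans.
have lt_pw : pairwise lt (enum 'I_n).
  by have := iota_ltn_sorted 0 n; rewrite -val_enum_ord sorted_map sorted_pairwise.
apply: (irr_sorted_eq lt_trans) => [i||| j]; first exact: ltnn.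
- by rewrite sorted_pairwise.
- have below i j : i \in I -> [forall i in I, j < i] -> j < i.
    by move=> iI /forall_inP/(_ i iI).
  have above i j : i \in I -> [forall i in I, i < j] -> i < j.
    by move=> iI /forall_inP/(_ i iI).
  have pwF A : pairwise lt [seq j <- enum 'I_n | A j] by apply: pairwise_filter.
  have pwI : pairwise lt (enum I) by rewrite pairwise_filter // -enumT.
  rewrite sorted_pairwise // !pairwise_cat !pwF pwI !andbT.
  apply/andP; split; apply/allrelP => i j.
    rewrite mem_filter mem_cat => /andP[iL _]; rewrite mem_enum mem_filter.
    case/orP=> [jI|/andP[jR _]]; first exact: below.
    (* A point of the nonempty set [I] separates the lower part from the upper one. *)
    exact: ltn_trans (below i0 i i0I iL) (above i0 j i0I jR).
  by rewrite mem_enum mem_filter => iI /andP[jR _]; apply: above.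
- have memF A : (j \in [seq j <- enum 'I_n | A j]) = A j.
    by rewrite mem_filter mem_enum andbT.
  rewrite !mem_cat !memF !mem_enum; symmetry.
  (* If [j] is neither below nor above [I], then [k <= j <= l] for some [k] and [l] in [I], and
     convexity applies. *)
  have [//|/forall_inPn[k kI jk]] := boolP [forall i in I, j < i].
  have [_|/forall_inPn[l lI jl]] := boolP [forall i in I, i < j].
    by rewrite orbT.
  rewrite orbF; have /forall_inP/(_ l lI)/forallP/(_ j) := convI k kI.
  by rewrite leqNgt jk leqNgt jl.
Qed.

(** * Loops of the generators *)

Section RaagIso.
Variables (n : nat) (C : {set interval n}).
Local Notation P := (interval_presentation C).
Local Notation member := (member C).
Local Notation word := (word P).
Local Notation sqedge := (edge (squier_complex P)).
Local Notation xI I := (xword C (val (I : member))).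
Local Notation x0 := (xword C [set: 'I_n]).
Local Notation L := (compl_graph (interval_graph C)).

Definition xprefix (I : member) : word :=
  [seq x_ C j | j : 'I_n <- enum 'I_n & [forall i in interval_set (val I), j < i]].

Definition xsuffix (I : member) : word :=
  [seq x_ C j | j : 'I_n <- enum 'I_n & [forall i in interval_set (val I), i < j]].

Lemma xword_split I : x0 = xprefix I ++ xI I ++ xsuffix I.
Proof.
by rewrite /xword enum_setT -enumT (enum_interval (valP (val I))) !map_cat.
Qed.

Lemma x_inj : injective (@x_ n C).
Proof. by move=> i j []. Qed.

Lemma uniq_xword I : uniq (xword C I).
Proof. by rewrite map_inj_uniq ?enum_uniq //; apply: x_inj. Qed.

Lemma mem_xword i (I : {set 'I_n}) : (x_ C i \in xword C I) = (i \in I).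
Proof. by rewrite mem_map ?mem_enum //; apply: x_inj. Qed.

Lemma xword_neq0 (I : member) : xI I != [::].
Proof.
have /andP[/set0Pn[i iI] _] := valP (val I).
by apply/eqP=> e; have := mem_xword i (val I); rewrite e iI.
Qed.

(** The letters of [x_1 ... x_n] are distinct, so [x_I] occurs at one place only. Thus the loop of a
    labelled edge depends on its interval and not on the context of the edge. *)
Lemma xword_split_inj I a b :
  a ++ xI I ++ b = x0 -> a = xprefix I /\ b = xsuffix I.
Proof.
move=> e; apply: (uniq_cat_inj (xword_neq0 I)); first by rewrite e uniq_xword.
by rewrite e -xword_split.
Qed.

(** Disjointness already forces [I != J], because an interval is nonempty and so meets itself. *)
Lemma compl_edgeP (I J : member) :
  reflect (forall x, x \in xI I -> x \notin xI J) (@sedge L I J).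
Proof.
have -> : @sedge L I J = (interval_set (val I) :&: val J == set0).
  rewrite /= /compl_edge /= /intersect_edge negb_and.
  case: eqP => [->|_] /=; last by rewrite negbK.
  by rewrite setIid; have /andP[/negbTE->] := valP (val J).
apply: (iffP eqP) => [IJ0 x /mapP[i]|dis].
  rewrite mem_enum => iI ->; rewrite mem_xword.
  by apply: contra_eqN IJ0 => iJ; apply/set0Pn; exists i; rewrite inE iI.
apply/setP=> i; rewrite !inE; apply/negP=> /andP[iI iJ].
by have := dis (x_ C i); rewrite !mem_xword iI iJ => /(_ isT).
Qed.

Definition generator_loop (x : member * bool) : seq sqedge :=
  whisker_path (xprefix x.1) (xsuffix x.1) (local_letter x).

Definition artin_loop (w : gword member) : seq sqedge := flatten (map generator_loop w).

Lemma artin_loop_cat w w' : artin_loop (w ++ w') = artin_loop w ++ artin_loop w'.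
Proof. by rewrite /artin_loop map_cat flatten_cat. Qed.

Lemma artin_loop2 x y : artin_loop [:: x; y] = generator_loop x ++ generator_loop y.
Proof. by rewrite /artin_loop /= cats0. Qed.

Lemma word_path_generator_loop x : @word_path P x0 (generator_loop x) x0.
Proof.
case: x => I b; rewrite (xword_split I); apply: word_path_whisker.
by case: b; [|apply: edge_path_rev]; apply: word_path_triangle.
Qed.

Lemma word_path_artin_loop w : @word_path P x0 (artin_loop w) x0.
Proof.
elim: w => [|x w ih]; first exact: eqxx.
exact: word_path_cat (word_path_generator_loop x) ih.
Qed.

Lemma generator_loopV I b : generator_loop (I, ~~ b) = Defs.rev_path (generator_loop (I, b)).
Proof.
rewrite /generator_loop -whisker_rev_path; case: b => //; congr whisker_path.
exact/esym/rev_pathK.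
Qed.

Lemma whisker_local_loop a b (u v : word) : @valid_move P u v ->
  expand (a ++ u ++ b) = x0 ->
  whisker_path (expand a) (expand b) (local_loop (move_label u v)) =
  artin_loop (move_label u v).
Proof.
rewrite !expand_cat; case/move_labelP=> [->//|[I [c [-> ->]]]].
by case/xword_split_inj=> -> ->; rewrite /artin_loop /local_loop /= !cats0.
Qed.

(** Induction on the last edge, by [canonical_path_edge]. When [w] is [x_1 ... x_n] the canonical
    path is empty, so a loop is homotopic to the loop of its label. *)
Lemma path_homotopic_to_label p w : @word_path P x0 p w ->
  @word_homotopy P x0 w p (artin_loop (path_label p) ++ canonical_path w).
Proof.
elim/last_ind: p w => [|p e ih] w hp.
  move/eqP/squier_vertex_inj: hp => <-; rewrite canonical_path_xword.
  exact/wh_refl/eqxx.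
have [y py ey] : exists2 y, @edge_path (squier_complex P) (@squier_vertex P x0) p y
    & @edge_path (squier_complex P) y [:: e] (squier_vertex w).
  by apply: edge_path_cat; rewrite cats1.
have [v yv] := squier_vertexP y; rewrite {}yv in py ey.
have ev : expand v = x0 by rewrite -(expand_path py) expand_xword.
have [a [b [s [t [h ee]]]]] := squier_edgeP e; rewrite {}ee in hp ey *.
have [ev' ew] := word_path_moveP ey; rewrite {}ev' {}ew in ev ey py *.
rewrite -cats1 path_label_cat artin_loop_cat.
apply: word_homotopy_trans (ph_cat (ih _ py) (wh_refl ey)) _.
rewrite -!catA; apply: ph_cat (wh_refl (word_path_artin_loop _)) _.
have := canonical_path_edge a b h; rewrite (whisker_local_loop h ev) ev.
by rewrite /path_label /= cats0.
Qed.

Lemma artin_loop_commute (I J : member) : @sedge L I J ->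
  @word_homotopy P x0 x0 (artin_loop [:: (I, true); (J, true)])
    (artin_loop [:: (J, true); (I, true)]).
Proof.
(* By symmetry, [I] may be taken to lie to the left of [J]. *)
wlog le_IJ : I J / size (xprefix I) <= size (xprefix J).
  move=> wl IJ; case: (leqP (size (xprefix I)) (size (xprefix J))) => [le|/ltnW le].
    exact: wl.
  by apply/ph_sym/wl; rewrite // sedge_sym.
move/compl_edgeP=> dis.
have [b eJ eI] := cat_disjoint_split (xword_neq0 J) dis le_IJ
  (etrans (esym (xword_split I)) (xword_split J)).
(* The letters [b] between the two intervals go with the triangle of [I], so that the two factors
   make up the whole of [x_1 ... x_n] and [exchange] applies. *)
have ta := word_path_whisker (xprefix I) b (word_path_triangle I).
have tb := word_path_rwhisker (xsuffix J) (word_path_triangle J).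
have := exchange ta tb.
rewrite !whisker_pathM !cats0 !cat0s -eI -eJ -xword_split.
by rewrite !artin_loop2.
Qed.

Lemma artin_loop_step w w' : gword_step (@raag_relator L) w w' ->
  @word_homotopy P x0 x0 (artin_loop w) (artin_loop w').
Proof.
have ctx p q r : @word_homotopy P x0 x0 (artin_loop r) [::] ->
    @word_homotopy P x0 x0 (artin_loop (p ++ q)) (artin_loop (p ++ r ++ q)).
  move=> hr; rewrite !artin_loop_cat; apply: ph_cat (wh_refl (word_path_artin_loop p)) _.
  exact: ph_sym (ph_cat hr (wh_refl (word_path_artin_loop q))).
case=> [p q I b|p q r [I J IJ]]; apply: ctx.
  rewrite artin_loop2 generator_loopV; exact: ph_rev (word_path_generator_loop _).
(* The commutator is the product of [I J] and the inverse of [J I]; once [I J] is exchanged for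
   [J I], a loop followed by its reverse remains. *)
have -> : [:: (I, true); (J, true); (I, false); (J, false)] =
  [:: (I, true); (J, true)] ++ [:: (I, false); (J, false)] :> gword member by [].
rewrite artin_loop_cat; apply: word_homotopy_trans.
  exact: ph_cat (artin_loop_commute IJ) (wh_refl (word_path_artin_loop _)).
rewrite -artin_loop_cat.
have -> : artin_loop ([:: (J, true); (I, true)] ++ [:: (I, false); (J, false)]) =
    artin_loop [:: (J, true); (I, true)] ++ Defs.rev_path (artin_loop [:: (J, true); (I, true)]).
  rewrite artin_loop_cat; congr (_ ++ _).
  by rewrite !artin_loop2 rev_path_cat -!generator_loopV.
exact: ph_rev (word_path_artin_loop _).
Qed.

(** * Labels of loops and their invariance under homotopy *)

(** In a triangle, only the edge [c_I -> a_I] has a nontrivial label. *)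
Lemma path_label_artin_loop w : path_label (artin_loop w) = w.
Proof.
elim: w => [//|[I b] w ih].
rewrite -[artin_loop _]/(generator_loop _ ++ artin_loop w) path_label_cat ih.
by case: b; rewrite /path_label /= /edge_label /= /xword;
  case: (enum _) => [|i [|]].
Qed.

Local Notation raagD := (presented_groupData (@raag_relator L)).

(** The relators give the commutation of the positive letters; the other signs follow in the
    quotient group, where commuting passes to inverses. *)
Lemma gword_commute x y : @sedge L x.1 y.1 ->
  crst raagD [:: x; y] [:: y; x].
Proof.
move=> xy; apply: crst_pi.
have mulE (u v : raagD) : \pi_(quotGroup raagD) (u ++ v : gword member) =
    (\pi_(quotGroup raagD) u * \pi_(quotGroup raagD) v)%g.
  by apply/esym; apply: quot_mulE.
have invE I : \pi_(quotGroup raagD) ([:: (I, false)] : gword member) =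
    ((\pi_(quotGroup raagD) ([:: (I, true)] : gword member))^-1)%g.
  by apply/esym; apply: quot_invE.
rewrite -[[:: x; y]]/([:: x] ++ [:: y]) -[[:: y; x]]/([:: y] ++ [:: x]) !mulE.
have gen : commute (\pi_(quotGroup raagD) ([:: (x.1, true)] : gword member))
    (\pi_(quotGroup raagD) ([:: (y.1, true)] : gword member)).
  have : \pi_(quotGroup raagD)
    ([:: (x.1, true); (y.1, true); (x.1, false); (y.1, false)] : gword member) =
    1%g.
    apply/pi_crst/rst_sym/rst_step.
    exact: (@GwordRelator _ _ [::] [::] _ (RaagCommutator xy)).
  rewrite -[_ :: _]/([:: (x.1, true)] ++ [:: (y.1, true)] ++
    [:: (x.1, false)] ++ [:: (y.1, false)]) !mulE !invE mulgA.
  by rewrite -invgM => /eqP; rewrite mulg_eq1 invgK => /eqP.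
case: x y gen {xy} => I [] [J []] /= gen; rewrite ?invE.
- exact: gen.
- exact: commuteV.
- exact/commute_sym/commuteV/commute_sym.
- exact/commuteV/commute_sym/commuteV/commute_sym.
Qed.

Local Notation label := (@edge_label n C).

Lemma gword_crst_ctx (p r r' q : gword member) : crst raagD r r' ->
  crst raagD (p ++ r ++ q) (p ++ r' ++ q).
Proof.
move=> rr'; apply: (@crst_mul raagD p p (r ++ q) (r' ++ q)); first exact: rst_refl.
by apply: (@crst_mul raagD r r' q q); last exact: rst_refl.
Qed.

Lemma label_einv (e : sqedge) : label (einv e) = gword_inv (label e).
Proof.
have [a [b [u [v [h ->]]]]] := squier_edgeP e.
exact: move_labelV.
Qed.

(** Opposite sides carry the same label, so only two nontrivial labels need an argument. The path
    [p] places the square over [x_1 ... x_n]; its two moves then expand to separate factors of a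
    word without repetition, so their intervals are disjoint. *)
Lemma label_square (s : square (squier_complex P)) p q :
  @word_path P x0 (p ++ [:: face ord_max false s; face ord0 true s] ++ q) x0 ->
  crst raagD
    (label (face ord_max false s) ++ label (face ord0 true s))
    (label (face ord0 false s) ++ label (face ord_max true s)).
Proof.
case: s => -[[|[a1 [u u']] [|[a2 [v v']] [|? ?]]] b] //= hs.
have [hu hv] : @valid_move P u u' /\ @valid_move P v v'.
  by apply/andP; move: (hs); rewrite /= andbT.
case/edge_path_cat=> y py /andP[/eqP ey _].
have {}ey : y = @squier_vertex P (a1 ++ u ++ a2 ++ v ++ b).
  by rewrite -ey; apply: val_inj; rewrite /= -!catA.
rewrite {}ey in py.
have := expand_path py; rewrite expand_xword !expand_cat => e.
rewrite /edge_label /=.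
have [->|[I [c [-> eu]]]] := move_labelP hu; first by rewrite cats0; apply: rst_refl.
have [->|[J [d [-> ev]]]] := move_labelP hv; first exact: rst_refl.
apply: gword_commute; apply/compl_edgeP => x xin.
have := uniq_xword [set: 'I_n]; rewrite e eu ev catA cat_uniq.
case/and3P=> _ /hasPn dis _; apply/negP=> xJ.
have /dis : x \in expand a2 ++ xI J ++ expand b by rewrite !mem_cat xJ orbT.
by rewrite mem_cat xin orbT.
Qed.

Lemma label_step (l l' : loop (@squier_vertex P x0)) : homotopy_step l l' ->
  crst raagD (path_label l) (path_label l').
Proof.
case=> {l l'} l l' p q c el el'.
  rewrite el el' !path_label_cat; apply: (@gword_crst_ctx _ [::]).
  rewrite /path_label /= cats0 label_einv; apply: rst_sym.
  exact: gword_mulV.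
rewrite el el' !path_label_cat; apply: gword_crst_ctx.
rewrite /path_label /= !cats0; apply: (@label_square c p q).
by rewrite -el; apply: loopP.
Qed.

Definition artin_loop_at (w : gword member) : loop (@squier_vertex P x0) :=
  Loop (word_path_artin_loop w).

Lemma diagram_group_iso :
  isomorphic_groups (diagram_group (P := P) x0) (raag L).
Proof.
apply: (@quotGroup_iso (loop_groupData (@squier_vertex P x0)) raagD
  (fun l => path_label (loop_path l)) artin_loop_at).
- by move=> l m; apply: path_label_cat.
- exact: label_step.
- by move=> w w' /artin_loop_step h; apply: (ph_loop h).
- move=> l; have := path_homotopic_to_label (loopP l).
  rewrite canonical_path_xword cats0 => /ph_sym h.
  exact: (ph_loop h).
- by move=> w; rewrite /= path_label_artin_loop; apply: rst_refl.
Qed.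
End RaagIso.

Theorem theorem5p13 (n : nat) (hn : 1 <= n) (C : {set interval n}) :
  isomorphic_groups
    (diagram_group (P := interval_presentation C) (xword C [set: 'I_n]))
    (raag (compl_graph (interval_graph C))).
Proof. exact: diagram_group_iso. Qed.
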